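(* Fix constants $0<\epsilon\le 1$ and $k\in\mathbb{Z}_{\ge 2}$. The local search algorithm described in the context, run with parameters $\epsilon$ and $k$ on a Steiner tree instance $(G=(V,E),T,w)$, returns a Steiner tree solution $F$ with $w(F)\le(\ln 4+\epsilon)\cdot w(\mathrm{LP}_k)$, where $w(\mathrm{LP}_k)$ is the optimal value of the $k$-restricted directed component LP.
   Context: Steiner tree instance: undirected graph $G=(V,E)$, weights $w\colon E\to\mathbb{R}_{>0}$, terminals $T\subseteq V$; $n\coloneqq|V|$. A Steiner tree solution is $F\subseteq E$ such that $(V,F)$ contains a path between every pair of terminals. A component is a nonempty edge set $C\subseteq E$ forming a tree; $T_C$ is the set of terminals that are endpoints of edges of $C$; $C$ is a $k$-component if $|T_C|\le k$. $H_q\coloneqq\sum_{i=1}^q\frac1i$ ($H_0=0$). A terminal spanning tree is $S\subseteq\binom{T}{2}$ with $(T,S)$ a tree. $k$-restricted directed component LP: let $\vec{\mathcal{C}}_k\coloneqq\{(C,t): C\subseteq E \text{ a } k\text{-component}, t\in T_C\}$, fix an arbitrary terminal $r\in T$, and for $R\subseteq T$ let $\delta^-(R)\coloneqq\{(C,t)\in\vec{\mathcal{C}}_k: t\notin R, T_C\cap R\neq\emptyset\}$. The LP is $\min\sum_{(C,t)\in\vec{\mathcal{C}}_k}w(C)x_{C,t}$ subject to $\sum_{(C,t)\in\delta^-(R)}x_{C,t}\ge 1$ for all $\emptyset\neq R\subseteq T\setminus\{r\}$ and $x\ge 0$; $w(\mathrm{LP}_k)$ denotes its optimal value. Witness construction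 (a known result used by the algorithm): for every component $C$ one can efficiently compute a tree $S_C\subseteq\binom{T_C}{2}$ spanning $T_C$ such that, defining for $f\in C$ the witness set $W_f\coloneqq\{\{a,b\}\in S_C: f \text{ lies on the unique } a\text{-}b \text{ path in } C\}$, one has $\sum_{f\in C}H_{|W_f|}w(f)\le\ln(4)\cdot w(C)$. The algorithm maintains a set $F\subseteq E$ and witness sets $W_f\subseteq\binom{T}{2}$ for $f\in F$. Let $S\coloneqq\bigcup_{f\in F}W_f$, $\overline{w}(e)\coloneqq\sum_{f\in F: e\in W_f}\frac{w(f)}{|W_f|}$ for $e\in S$, and $\Phi(F)\coloneqq\sum_{f\in F}H_{|W_f|}w(f)$. For a component $C$, $\mathrm{Drop}^{\overline{w}}_S(C)$ is a set $D\subseteq S$ maximizing $\overline{w}(D)$ subject to $(S\setminus D)\cup S_C$ being a terminal spanning tree. Algorithm: (1) Let $F\subseteq E$ be an arbitrary Steiner tree solution whose edges form a tree, and obtain $W_f$ for $f\in F$ by applying the witness construction to $F$ viewed as one component. (2) Repeat: choose a $k$-component $C$ maximizing $\overline{w}(\mathrm{Drop}^{\overline{w}}_S(C))-\ln(4)\cdot w(C)$; the update replaces $W_f$ by $W_f\setminus\mathrm{Drop}^{\overline{w}}_S(C)$ for all $f\in F$, removes from $F$ every $f$ whose witness set became empty, and adds $C$ to $F$ with witness sets $W_f$ ($f\in C$) given by the witness construction for $C$. The iteration is continued as long as each update decreases $\Phi(F)$ by at least a factor $\bigl(1-\frac{\epsilon}{2H_n\ln(4)|T|}\bigr)$; otherwise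 the algorithm stops. (3) Return $F$.
   Formalization: Edges with empty witness set are removed also at initialization and after adding C (else w(F) can be unbounded relative to the LP); an edge in both F and C keeps its remaining old witnesses plus the new ones; an update must strictly decrease Φ (matters only if |T|=1). *)

(* Defs.v *)
From mathcomp Require Import all_boot all_order all_algebra.
From mathcomp Require Import boolp reals exp.

Set Implicit Arguments.
Unset Strict Implicit.
Unset Printing Implicit Defensive.

Import Order.TTheory GRing.Theory Num.Theory.
Local Open Scope ring_scope.
Local Open Scope set_scope.

(* Edges, and unordered pairs of terminals, are two-element sets of vertices. *)

Definition pairs (V : finType) (X : {set V}) : {set {set V}} :=
  [set e : {set V} | (e \subset X) && (#|e| == 2)].

Definition adj (V : finType) (S : {set {set V}}) : rel V :=
  fun x y => [set x; y] \in S.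

Definition path_edges (V : finType) (a : V) (p : seq V) : seq {set V} :=
  pairmap (fun x y => [set x; y]) a p.

(* [(X, S)] is connected and has no simple cycle with three or more vertices;
   a [ucycle] of size two just traverses one edge back and forth.  The empty
   graph is accepted, so that a component without terminals has the witness
   tree [set0]. *)
Definition tree_on (V : finType) (X : {set V}) (S : {set {set V}}) : Prop :=
  [/\ S \subset pairs X,
      {in X &, forall a b, connect (adj S) a b} &
      forall c : seq V, ucycle (adj S) c -> (size c <= 2)%N].

Definition Harm (R : realType) (q : nat) : R := \sum_(1 <= i < q.+1) i%:R^-1.

Record steiner_instance (R : realType) := SteinerInstance {
  vertex : finType;
  edges : {set {set vertex}};
  weight : {set vertex} -> R;
  terminals : {set vertex};
  edges_pairs : edges \subset pairs [set: vertex];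
  weight_gt0 : forall e, e \in edges -> 0 < weight e
}.

Notation edgeset I := {set {set vertex I}}.

Definition wsum (R : realType) (I : steiner_instance R) (F : edgeset I) : R :=
  \sum_(f in F) weight f.

Definition steiner_solution (R : realType) (I : steiner_instance R)
    (F : edgeset I) : Prop :=
  F \subset edges I /\ {in terminals I &, forall a b, connect (adj F) a b}.

Definition component (R : realType) (I : steiner_instance R)
    (C : edgeset I) : Prop :=
  [/\ C \subset edges I, C != set0 & tree_on (cover C) C].

Definition cterm (R : realType) (I : steiner_instance R) (C : edgeset I) :
    {set vertex I} :=
  terminals I :&: cover C.

Definition kcomponent (R : realType) (I : steiner_instance R) (k : nat)
    (C : edgeset I) : Prop :=
  component C /\ (#|cterm C| <= k)%N.

Definition terminal_spanning_tree (R : realType) (I : steiner_instance R)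
    (S : edgeset I) : Prop :=
  tree_on (terminals I) S.

Definition dcomponents (R : realType) (I : steiner_instance R) (k : nat) :
    {set edgeset I * vertex I} :=
  [set p | `[< kcomponent k p.1 >] && (p.2 \in cterm p.1)].

Definition deltam (R : realType) (I : steiner_instance R) (k : nat)
    (Q : {set vertex I}) : {set edgeset I * vertex I} :=
  [set p in dcomponents I k | (p.2 \notin Q) && (cterm p.1 :&: Q != set0)].

Definition lp_feasible (R : realType) (I : steiner_instance R) (k : nat)
    (r : vertex I) (x : edgeset I * vertex I -> R) : Prop :=
  (forall p, p \in dcomponents I k -> 0 <= x p) /\
  (forall Q : {set vertex I}, Q != set0 -> Q \subset terminals I :\ r ->
     1 <= \sum_(p in deltam k Q) x p).

Definition lp_cost (R : realType) (I : steiner_instance R) (k : nat)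
    (x : edgeset I * vertex I -> R) : R :=
  \sum_(p in dcomponents I k) wsum p.1 * x p.

Definition lp_value (R : realType) (I : steiner_instance R) (k : nat)
    (r : vertex I) : R :=
  inf (fun v : R =>
    exists2 x : edgeset I * vertex I -> R, lp_feasible k r x & v = lp_cost k x).

(* The witness construction is an arbitrary map [wit], [wit C] being [S_C]. *)

(* When [C] is a tree, the simple path [p] from [a] to [b] is unique. *)
Definition witness (R : realType) (I : steiner_instance R)
    (wit : edgeset I -> edgeset I) (C : edgeset I) (f : {set vertex I}) :
    edgeset I :=
  [set e in wit C | `[< exists a b (p : seq (vertex I)),
     [/\ e = [set a; b], path (adj C) a p, uniq (a :: p), last a p = b &
         f \in path_edges a p] >] ].

Definition witness_construction (R : realType) (I : steiner_instance R)
    (wit : edgeset I -> edgeset I) : Prop :=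
  forall C : edgeset I, component C ->
    tree_on (cterm C) (wit C) /\
    \sum_(f in C) Harm R #|witness wit C f| * weight f <= ln 4 * wsum C.

Record state (R : realType) (I : steiner_instance R) := State {
  sol : edgeset I;
  wset : {set vertex I} -> edgeset I
}.

Definition wtree (R : realType) (I : steiner_instance R) (st : state I) :
    edgeset I :=
  \bigcup_(f in sol st) wset st f.

Definition wbar (R : realType) (I : steiner_instance R) (st : state I)
    (e : {set vertex I}) : R :=
  \sum_(f in sol st | e \in wset st f) weight f / #|wset st f|%:R.

Definition wbarsum (R : realType) (I : steiner_instance R) (st : state I)
    (D : edgeset I) : R :=
  \sum_(e in D) wbar st e.

Definition potential (R : realType) (I : steiner_instance R) (st : state I) :
    R :=
  \sum_(f in sol st) Harm R #|wset st f| * weight f.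

Definition drop_candidate (R : realType) (I : steiner_instance R)
    (wit : edgeset I -> edgeset I) (st : state I) (C D : edgeset I) : Prop :=
  D \subset wtree st /\ terminal_spanning_tree ((wtree st :\: D) :|: wit C).

(* [D] is a possible value of the Drop of [C]; ties are broken arbitrarily. *)
Definition is_drop (R : realType) (I : steiner_instance R)
    (wit : edgeset I -> edgeset I) (st : state I) (C D : edgeset I) : Prop :=
  drop_candidate wit st C D /\
  forall D', drop_candidate wit st C D' -> wbarsum st D' <= wbarsum st D.

Definition gain (R : realType) (I : steiner_instance R) (st : state I)
    (C D : edgeset I) : R :=
  wbarsum st D - ln 4 * wsum C.

Definition best_choice (R : realType) (I : steiner_instance R)
    (wit : edgeset I -> edgeset I) (k : nat) (st : state I)
    (C D : edgeset I) : Prop :=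
  [/\ kcomponent k C, is_drop wit st C D &
      forall C' D', kcomponent k C' -> is_drop wit st C' D' ->
        gain st C' D' <= gain st C D].

(* Removes the edges with an empty witness set.  Every edge of the maintained
   solution must have a nonempty witness set, but a component may contain edges
   that lie on no path between two of its terminals; pruning is therefore done
   each time witness sets are assigned. *)
Definition prune (R : realType) (I : steiner_instance R) (st : state I) :
    state I :=
  State [set f in sol st | wset st f != set0] (wset st).

Definition init_state (R : realType) (I : steiner_instance R)
    (wit : edgeset I -> edgeset I) (F0 : edgeset I) : state I :=
  prune (State F0 (witness wit F0)).

(* An edge that stays in the solution and also belongs to [C] keeps its
   remaining old witnesses together with those it receives from [C]. *)
Definition update (R : realType) (I : steiner_instance R)
    (wit : edgeset I -> edgeset I) (st : state I) (C D : edgeset I) : state I :=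
  prune (State (sol st :|: C) (fun f =>
    (if f \in sol st then wset st f :\: D else set0) :|:
    (if f \in C then witness wit C f else set0))).

(* The strict inequality is implied by the second one unless the potential is
   zero, which happens only when there is a single terminal. *)
Definition enough_decrease (R : realType) (I : steiner_instance R) (eps : R)
    (st st' : state I) : Prop :=
  potential st' < potential st /\
  potential st' <=
    (1 - eps / (2 * Harm R #|vertex I| * ln 4 * #|terminals I|%:R))
    * potential st.

Inductive ls_step (R : realType) (I : steiner_instance R)
    (wit : edgeset I -> edgeset I) (eps : R) (k : nat) (st : state I) :
    state I -> Prop :=
  LsStep C D :
    best_choice wit k st C D -> enough_decrease eps st (update wit st C D) ->
    ls_step wit eps k st (update wit st C D).

Inductive ls_reachable (R : realType) (I : steiner_instance R)
    (wit : edgeset I -> edgeset I) (eps : R) (k : nat) : state I -> Prop :=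
| ReachInit F0 :
    steiner_solution F0 -> component F0 ->
    ls_reachable wit eps k (init_state wit F0)
| ReachStep st st' :
    ls_reachable wit eps k st -> ls_step wit eps k st st' ->
    ls_reachable wit eps k st'.

(* The update that does not decrease the potential enough is not performed. *)
Definition ls_returns (R : realType) (I : steiner_instance R)
    (wit : edgeset I -> edgeset I) (eps : R) (k : nat) (F : edgeset I) : Prop :=
  exists st C D,
    [/\ ls_reachable wit eps k st, best_choice wit k st C D,
        ~ enough_decrease eps st (update wit st C D) & F = sol st].

Definition ls_terminates (R : realType) (I : steiner_instance R)
    (wit : edgeset I -> edgeset I) (eps : R) (k : nat) : Prop :=
  ~ exists st : nat -> state I,
      ls_reachable wit eps k (st 0%N) /\
      forall i, ls_step wit eps k (st i) (st i.+1).

Definition ls_never_stuck (R : realType) (I : steiner_instance R)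
    (wit : edgeset I -> edgeset I) (eps : R) (k : nat) : Prop :=
  forall st : state I, ls_reachable wit eps k st ->
    exists C D, best_choice wit k st C D.

(* Main.v *)
Require Import Defs.
From mathcomp Require Import all_boot all_order all_algebra.
From mathcomp Require Import boolp reals exp.
From mathcomp Require Import ring lra.

Set Implicit Arguments.
Unset Strict Implicit.
Unset Printing Implicit Defensive.

Import Order.TTheory GRing.Theory Num.Theory.
Local Open Scope ring_scope.

(** The potential is at most [H_n w(F)], and an update lowers it by at least the
    gain of the chosen component.  So when the search stops, every gain is at
    most a small [g], and it remains to bound the weight of the terminal tree
    [S] under [wbar] (which is [w(F)]) by [ln 4 * LP + g |T|].

    Let [c] be nonnegative weights on [S].  For a component [C], the greedy drop
    consists of the edges of [S] whose ends are joined by [S_C] and the edges of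
    [S] that come earlier in increasing order of weight.  The LP cut
    inequalities for the blocks spanned by the [j] lightest edges of [S], for
    every [j], combine by Abel summation into
    [c(S) <= \sum x_(C,t) c(greedy C)].  Applied to [c = max(0, wbar - g)], for
    which a drop costs at most [max(0, wbar(drop) - g) <= ln 4 * w(C)], this
    gives [w(F) - g |T| <= ln 4 * LP] without any bound on the total mass of
    [x]. *)

(** * Connected components of edge sets, and the greedy drop *)

Section EdgeGraphs.
Variable V : finType.
Implicit Types (S W A D : {set {set V}}) (X U : {set V}) (s : seq {set V}).

Lemma adj_sym S : symmetric (adj S).
Proof. by move=> x y; rewrite /adj setUC. Qed.

Lemma connect_adj_sym S : connect_sym (adj S).
Proof. exact/sym_connect_sym/adj_sym. Qed.

Lemma connect_adjS S S' x y :
  S \subset S' -> connect (adj S) x y -> connect (adj S') x y.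
Proof.
by move=> sSS'; apply: connect_sub => a b ab; apply/connect1/(subsetP sSS').
Qed.

Lemma eq_set2 (a b x y : V) :
  [set a; b] = [set x; y] -> (a = x /\ b = y) \/ (a = y /\ b = x).
Proof.
move=> E; have aE : a \in [set x; y] by rewrite -E set21.
have bE : b \in [set x; y] by rewrite -E set22.
have xE : x \in [set a; b] by rewrite E set21.
have yE : y \in [set a; b] by rewrite E set22.
by case/set2P: aE; case/set2P: bE; case/set2P: xE; case/set2P: yE; intuition congruence.
Qed.

Lemma pairsP X e : reflect (exists a b, [/\ a \in X, b \in X, a != b & e = [set a; b]])
  (e \in pairs X).
Proof.
apply: (iffP idP) => [|[a [b [aX bX ab ->]]]].
  rewrite inE => /andP[/subsetP eX /cards2P[a [b [ab Ee]]]]; exists a, b.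
  by split=> //; apply: eX; rewrite Ee !inE eqxx ?orbT.
by rewrite inE cards2 ab eqxx andbT; apply/subsetP=> z; rewrite !inE => /orP[]/eqP->.
Qed.

Lemma pairsS X X' : X \subset X' -> pairs X \subset pairs X'.
Proof.
move=> sXX'; apply/subsetP=> e; rewrite !inE => /andP[eX ->].
by rewrite (subset_trans eX).
Qed.

Lemma pairs_neq X a b : [set a; b] \in pairs X -> a != b.
Proof. by rewrite inE cards2 => /andP[_]; case: (a != b). Qed.

Lemma connect_addP S x y a b : connect (adj ([set x; y] |: S)) a b ->
  [\/ connect (adj S) a b,
      connect (adj S) a x /\ connect (adj S) y b |
      connect (adj S) a y /\ connect (adj S) x b].
Proof.
case/connectP=> p; elim: p a => [|c p IH] a /=; first by move=> _ ->; constructor 1.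
case/andP=> ac pth Eb; have {}IH := IH c pth Eb.
move: ac; rewrite /adj in_setU1 => /orP[/eqP/eq_set2[][Ea Ec]|ac]; subst.
- case: IH => [H|[_ H]|[_ H]]; first by constructor 2; rewrite connect0.
    by constructor 2; rewrite connect0.
  by constructor 1.
- case: IH => [H|[_ H]|[_ H]]; first by constructor 3; rewrite connect0.
    by constructor 1.
  by constructor 3; rewrite connect0.
have ac1 : connect (adj S) a c by apply: connect1.
case: IH => [H|[H1 H]|[H1 H]]; [constructor 1|constructor 2|constructor 3].
- exact: connect_trans H.
- by rewrite (connect_trans ac1).
- by rewrite (connect_trans ac1).
Qed.

(** The connected components of [S] that meet [U], each encoded by its canonical representative,
    which need not lie in [U]. *)
Definition blocks S U : {set V} := fingraph.root (adj S) @: U.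

Lemma root_adjE S x y : (fingraph.root (adj S) x == fingraph.root (adj S) y) = connect (adj S) x y.
Proof. exact/root_connect/connect_adj_sym. Qed.

Lemma root_rootS S S' x : S \subset S' ->
  fingraph.root (adj S') (fingraph.root (adj S) x) = fingraph.root (adj S') x.
Proof.
move=> sSS'; apply/eqP; rewrite root_adjE connect_adj_sym.
exact: connect_adjS sSS' (connect_root _ _).
Qed.

Lemma blocksS S S' U : S \subset S' -> blocks S' U = fingraph.root (adj S') @: blocks S U.
Proof.
move=> sSS'; rewrite /blocks -imset_comp; apply: eq_imset => x /=.
by rewrite root_rootS.
Qed.

Lemma root_addP S x y a b :
  fingraph.root (adj ([set x; y] |: S)) a = fingraph.root (adj ([set x; y] |: S)) b ->
  let r := fingraph.root (adj S) in
  [\/ r a = r b, r a = r x /\ r b = r y | r a = r y /\ r b = r x].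
Proof.
move=> /eqP; rewrite root_adjE => /connect_addP[|[]|[]].
- by rewrite -root_adjE => /eqP ?; constructor 1.
- by rewrite -!root_adjE => /eqP ? /eqP ?; constructor 2.
- by rewrite -!root_adjE => /eqP ? /eqP ?; constructor 3.
Qed.

(** The new edge can only merge the components of [x] and [y], and the count changes only if both
    meet [U]. *)
Lemma card_blocks_add1 S x y U :
  (#|blocks S U| <= #|blocks ([set x; y] |: S) U| +
    ((fingraph.root (adj S) x \in blocks S U) && (fingraph.root (adj S) y \in blocks S U)))%N.
Proof.
set S' := _ |: S; have sSS' : S \subset S' by exact: subsetUr.
rewrite (blocksS U sSS'); set B := blocks S U.
have rB z : z \in B -> fingraph.root (adj S) z = z.
  by case/imsetP=> u _ ->; apply/root_root/connect_adj_sym.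
have [/andP[xB yB]|nB] := boolP (_ && _).
  rewrite addn1 (cardsD1 (fingraph.root (adj S) x)) xB add1n ltnS.
  rewrite -(@card_in_imset _ _ (fingraph.root (adj S'))) ?subset_leq_card ?imsetS ?subD1set //.
  move=> a b; rewrite !inE => /andP[ax aB] /andP[bx bB] /root_addP /=.
  rewrite (rB a) // (rB b) // => -[//|[E _]|[_ E]]; first by rewrite E eqxx in ax.
  by rewrite E eqxx in bx.
rewrite addn0 card_in_imset // => a b aB bB /root_addP /=.
rewrite (rB a) // (rB b) // => -[//|[Ea Eb]|[Ea Eb]]; case/negP: nB;
  by rewrite -Ea -Eb aB bB.
Qed.

(** The representatives of [x] and [y] are distinct before the edge is added and are identified
    afterwards, so one of them can be left out without changing the image. *)
Lemma card_blocks_add1_lt S x y U : x \in U -> y \in U ->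
  ~~ connect (adj S) x y -> (#|blocks ([set x; y] |: S) U| < #|blocks S U|)%N.
Proof.
move=> xU yU; rewrite -root_adjE => nxy.
set S' := _ |: S; have sSS' : S \subset S' by exact: subsetUr.
rewrite (blocksS U sSS'); set B := blocks S U.
have xB : fingraph.root (adj S) x \in B by apply: imset_f.
have yB : fingraph.root (adj S) y \in B by apply: imset_f.
rewrite [X in (_ < X)%N](cardsD1 (fingraph.root (adj S) x)) xB add1n ltnS.
apply: leq_trans (leq_imset_card (fingraph.root (adj S')) _).
apply/subset_leq_card/subsetP=> _ /imsetP[z zB ->].
have [->|zx] := eqVneq z (fingraph.root (adj S) x); last by apply: imset_f; rewrite !inE zx.
apply/imsetP; exists (fingraph.root (adj S) y); first by rewrite !inE eq_sym nxy.
rewrite !root_rootS //; apply/eqP; rewrite root_adjE; apply: connect1.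
by rewrite /adj setU11.
Qed.

(** A simple path in [A] from [x] to [y] closes up with the edge to a cycle in [S]. Such a cycle has
    at most two vertices, so the path would be the edge itself. *)
Lemma tree_on_bridge X S A x y : tree_on X S -> A \subset S ->
  [set x; y] \in S -> [set x; y] \notin A -> ~~ connect (adj A) x y.
Proof.
case=> /subsetP sS _ acS /subsetP sAS xyS xyA; apply/negP=> /connectP[p0 p0th].
case/shortenP: p0th => p pth up _ Ey.
have xy : x != y by apply: pairs_neq (sS _ xyS).
have: ucycle (adj S) (x :: p).
  rewrite /ucycle up andbT /= rcons_path -Ey [adj S y x]adj_sym /adj xyS andbT.
  by apply: sub_path pth => a b; exact: sAS.
move/acS; case: p pth {up} Ey => [|z [|//]] /=; first by move=> _ E; rewrite E eqxx in xy.
by rewrite andbT /adj => xzA Ez; rewrite Ez xzA in xyA.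
Qed.

Lemma path_belast_sub (T : eqType) (e e' : rel T) x p : path e x p ->
  (forall z w, z \in belast x p -> e z w -> e' z w) -> path e' x p.
Proof.
elim: p x => //= y p IH x /andP[xy pth] H; apply/andP; split.
  by apply: H xy; rewrite inE eqxx.
by apply: IH => // z w zp; apply: H; rewrite inE zp orbT.
Qed.

(** The list [s] will be sorted by increasing weight; its positions also break ties. *)
Definition lighter s e : {set {set V}} := [set f in take (index e s) s].

(** The edges that Kruskal's algorithm rejects when it starts from [W] and scans [s]. *)
Definition greedy s W : {set {set V}} :=
  [set e in s | [exists x, exists y,
     (e == [set x; y]) && connect (adj (lighter s e :|: W)) x y]].

Lemma greedyP s W x y : [set x; y] \in s ->
  ([set x; y] \in greedy s W) = connect (adj (lighter s [set x; y] :|: W)) x y.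
Proof.
move=> es; rewrite inE es /=; apply/existsP/idP => [[a /existsP[b]]|xy].
  case/andP=> /eqP/eq_set2[][-> ->] //; by rewrite connect_adj_sym.
by exists x; apply/existsP; exists y; rewrite eqxx.
Qed.

Lemma lighterP s e f : (f \in lighter s e) -> (index f s < index e s)%N /\ f \in s.
Proof.
rewrite inE => fe; have fs := mem_take fe; split=> //.
by move: fe; rewrite in_take.
Qed.

(** By strong induction on the position in [s]: a dropped edge is bypassed by [W] and earlier edges,
    and those are kept or bypassed in turn. *)
Lemma greedy_connect s W x y : [set x; y] \in s ->
  connect (adj (([set e in s] :\: greedy s W) :|: W)) x y.
Proof.
move: {2}(index _ _).+1 (ltnSn (index [set x; y] s)) => n.
elim: n x y => // n IH x y; rewrite ltnS => len es.
have [eD|eD] := boolP ([set x; y] \in greedy s W); last first.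
  by apply: connect1; rewrite /adj in_setU in_setD eD inE es.
move: eD; rewrite greedyP //; apply: connect_sub => a b.
rewrite /adj inE => /orP[/lighterP[lt fs]|fW].
  by apply: IH => //; apply: leq_trans lt len.
by apply: connect1; rewrite /adj inE fW orbT.
Qed.

(** On a cycle of at least three vertices that is not inside [W], take the edge outside [W] that
    comes last in [s]. The rest of the cycle joins its ends by [W] and earlier edges, so this edge
    was dropped. *)
Lemma greedy_acyclic s W (c : seq V) :
  (forall c', ucycle (adj W) c' -> (size c' <= 2)%N) ->
  ucycle (adj (([set e in s] :\: greedy s W) :|: W)) c -> (size c <= 2)%N.
Proof.
move=> acW; set N := _ :|: W => /andP[cyc uc].
have nN z : z \in c -> [set z; next c z] \in N by move=> zc; exact: (next_cycle cyc zc).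
pose ed z := [set z; next c z].
have [/existsP[x0 x0P]|allW] := boolP [exists x, (x \in c) && (ed x \notin W)]; last first.
  apply: acW; rewrite /ucycle uc andbT.
  apply: cycle_from_next => // z zc.
  by move: allW; rewrite negb_exists => /forallP/(_ z); rewrite zc negbK.
rewrite leqNgt; apply/negP=> gt2.
case: (@arg_maxnP _ x0 (fun x => (x \in c) && (ed x \notin W))
         (fun x => index (ed x) s)) => // x /andP[xc xW] xmax.
have [i q Ec] := rot_to xc.
have fc : fcycle (next c) (x :: q) by rewrite -Ec rot_cycle cycle_next.
have uq : uniq (x :: q) by rewrite -Ec rot_uniq.
have sq : (2 < size (x :: q))%N by rewrite -Ec size_rot.
have mq z : (z \in x :: q) = (z \in c) by rewrite -Ec mem_rot.
case: q {Ec} => // y [//|z' q'] in fc uq sq mq *.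
move: (fc) => /= /andP[/eqP nx /andP[/eqP ny _]].
have es : [set x; y] \in s /\ [set x; y] \notin greedy s W.
  have := nN _ xc; rewrite /N in_setU (negbTE xW) orbF nx in_setD inE => /andP[-> ->] //.
case: es => es /negP; apply; rewrite greedyP // connect_adj_sym.
apply/connectP; exists (rcons (z' :: q') x); last by rewrite last_rcons.
have fp : fpath (next c) y (rcons (z' :: q') x) by case/andP: fc.
apply: (path_belast_sub fp) => z w; rewrite belast_rcons => zq /eqP <-{w}.
have zc : z \in c by rewrite -mq inE zq orbT.
rewrite /adj in_setU -/(ed z); have [//|zW] := boolP (ed z \in W); first by rewrite orbT.
have := nN _ zc; rewrite -/(ed z) /N in_setU (negbTE zW) orbF in_setD inE => /andP[_ zs].
have zx : (index (ed z) s <= index (ed x) s)%N by apply: xmax; rewrite zc.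
rewrite orbF /lighter inE in_take // ltn_neqAle -nx -/(ed x) zx andbT.
(* Strictness: a cycle with more than two vertices does not traverse the same edge twice. *)
apply/negP=> /eqP E; have {}E : ed z = ed x.
  by rewrite -(nth_index set0 zs) E nth_index // /ed nx.
case: (eq_set2 E) => [[Ez _]|[zy nz]].
  by move: uq; rewrite cons_uniq -Ez zq.
rewrite zy nx ny in nz.
by move: uq; rewrite cons_uniq -nz !inE eqxx orbT.
Qed.

Lemma greedy_tree X S U W s : tree_on X S -> tree_on U W -> U \subset X ->
  s =i S -> tree_on X ((S :\: greedy s W) :|: W).
Proof.
move=> [sS cS _] [sW cW acW] UX sE.
have -> : S = [set e in s] by apply/setP=> e; rewrite inE sE.
split; last by move=> c; exact: greedy_acyclic.
  rewrite subUset (subset_trans sW (pairsS UX)) andbT.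
  by apply: subset_trans (subsetDl _ _) _; apply/subsetP=> e; rewrite inE sE => /(subsetP sS).
move=> a b aX bX; apply: connect_sub (cS _ _ aX bX) => x y xy.
by apply: greedy_connect; rewrite sE.
Qed.

End EdgeGraphs.

(** * From the cut inequalities to the greedy drops *)

Section Bridge.
Variables (V : finType) (R : realType).
Implicit Types (S W A D : {set {set V}}) (X U : {set V}) (s : seq {set V}).

Lemma take_nthS s j : (j < size s)%N ->
  [set e in take j.+1 s] = nth set0 s j |: [set e in take j s].
Proof.
by move=> js; apply/setP=> e; rewrite (take_nth set0) // !inE mem_rcons inE.
Qed.

Lemma nth_take_notin s j : uniq s -> (j < size s)%N ->
  nth set0 s j \notin [set e in take j s].
Proof. by move=> us js; rewrite inE in_take ?mem_nth // index_uniq // ltnn. Qed.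

Lemma card_blocks_take_lt X S s j : tree_on X S -> uniq s -> s =i S ->
  (j < size s)%N ->
  (#|blocks [set e in take j.+1 s] X| < #|blocks [set e in take j s] X|)%N.
Proof.
move=> tS us sE js; have eS : nth set0 s j \in S by rewrite -sE mem_nth.
have [/subsetP/(_ _ eS)/pairsP[x [y [xX yX xy E]]] _ _] := tS.
rewrite take_nthS // E; apply: card_blocks_add1_lt => //.
apply: (tree_on_bridge tS); rewrite -?E ?nth_take_notin //.
by apply/subsetP=> f; rewrite inE => /mem_take; rewrite sE.
Qed.

(** If the next edge merges two components that meet [U], then [W], which connects [U], joins its
    ends together with the earlier edges; hence the edge is in the greedy drop. *)
Lemma card_blocks_take_le X S s j U W : S \subset pairs X -> s =i S ->
  uniq s -> {in U &, forall a b, connect (adj W) a b} -> (j < size s)%N ->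
  (#|blocks [set e in take j s] U| <= #|blocks [set e in take j.+1 s] U| +
     (nth set0 s j \in greedy s W))%N.
Proof.
move=> /subsetP sS sE us cW js; have es : nth set0 s j \in s by rewrite mem_nth.
have /sS/pairsP[x [y [xX yX xy E]]] : nth set0 s j \in S by rewrite -sE.
rewrite take_nthS // E; apply: leq_trans (card_blocks_add1 _ x y _) _.
rewrite leq_add2l; case: andP => // -[/imsetP[u uU Eu] /imsetP[v vU Ev]].
rewrite lt0b greedyP -?E // /lighter index_uniq //.
set A := [set e in take j s] in Eu Ev *.
move/eqP: Eu; rewrite root_adjE => /(connect_adjS (subsetUl A W)) xu.
move/eqP: Ev; rewrite root_adjE connect_adj_sym => /(connect_adjS (subsetUl A W)) vy.
apply: connect_trans xu (connect_trans _ vy).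
exact: connect_adjS (subsetUr _ _) (cW _ _ uU vU).
Qed.

(** There are at most [#|X|] blocks at first, and each edge of a tree destroys one. *)
Lemma tree_on_card X S : tree_on X S -> (#|S| <= #|X|)%N.
Proof.
move=> tS; have sE : enum S =i S by exact: mem_enum.
suff H j : (j <= size (enum S))%N ->
    (#|blocks [set e in take j (enum S)] X| + j <= #|X|)%N.
  by have := H _ (leqnn _); rewrite -cardE; apply: leq_trans; apply: leq_addl.
elim: j => [_|j IH js]; first by rewrite addn0 leq_imset_card.
apply: leq_trans (IH (ltnW js)); rewrite addnS -addSn leq_add2r.
exact: (card_blocks_take_lt tS (enum_uniq _)).
Qed.

(** Summation by parts leaves nonnegative increments of [c] times [g], and a boundary term at [m].
    With [M] general, the induction can use [c m] as the bound for the earlier weights. *)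
Lemma abel_sum_ge (c g : nat -> R) m M : (forall j, 0 <= g j) ->
  {in gtn m, forall j, 0 <= c j <= M} -> 0 <= M ->
  {in gtn m &, {homo c : i j / (i <= j)%N >-> i <= j}} ->
  - (M * g m) <= \sum_(j < m) c j * (g j - g j.+1).
Proof.
move=> g0; elim: m M => [|m IH] M cM M0 ch.
  by rewrite big_ord0 oppr_le0 mulr_ge0.
have /andP[cm0 cmM] : 0 <= c m <= M by apply: cM; rewrite inE.
rewrite big_ord_recr /=.
have H : - (c m * g m) <= \sum_(i < m) c i * (g i - g i.+1).
  apply: IH => // [j|i j]; rewrite !inE => jm.
    have /andP[-> _] /= : 0 <= c j <= M by apply: cM; rewrite inE ltnW.
    by apply: ch; rewrite ?inE ?ltnS // ltnW.
  by move=> jm'; apply: ch; rewrite inE ltnW.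
have := ler_wpM2r (g0 m.+1) cmM; lra.
Qed.

(** An abstract form of the LP: [C] stands for the directed components, [X] for the terminals, [U p]
    for the terminals of [p], and [t p] for its distinguished terminal. *)
Variables (P : finType) (C : {set P}) (x : P -> R) (X : {set V}) (r : V).
Variables (U : P -> {set V}) (t : P -> V).
Hypothesis rX : r \in X.
Hypothesis x_ge0 : {in C, forall p, 0 <= x p}.
Hypothesis tU : {in C, forall p, t p \in U p}.
Hypothesis UX : {in C, forall p, U p \subset X}.
Hypothesis cuts : forall Q : {set V}, Q != set0 -> Q \subset X :\ r ->
  1 <= \sum_(p in C | (t p \notin Q) && (U p :&: Q != set0)) x p.

(** Add up the cut inequalities for all blocks of [X] except that of [r]. An index [p] only
    contributes to blocks that meet [U p] and differ from the block of [t p]. *)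
Lemma cuts_blocks A : #|blocks A X|%:R - 1 <=
  \sum_(p in C) x p * (#|blocks A (U p)|%:R - 1).
Proof.
pose rt := fingraph.root (adj A); pose B := blocks A X :\ rt r.
have cD1 (Y : {set V}) y : y \in Y -> #|blocks A Y|%:R - 1 = #|blocks A Y :\ rt y|%:R :> R.
  by move=> yY; rewrite (cardsD1 (rt y)) imset_f // natrD addrC addKr.
rewrite (cD1 X r) // -/B -sumr_const.
pose Q b := [set v in X | rt v == b].
have := @ler_sum _ _ (index_enum V) (mem B) (fun=> 1)
  (fun b => \sum_(p in C | (t p \notin Q b) && (U p :&: Q b != set0)) x p).
move=> /(_ _)/le_trans; apply=> [b|].
  rewrite !inE => /andP[br /imsetP[v vX Ev]]; apply: cuts.
    by apply/set0Pn; exists v; rewrite inE vX Ev eqxx.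
  apply/subsetP=> z; rewrite !inE => /andP[-> /eqP Ez]; rewrite andbT.
  by apply: contraNneq br => <-; rewrite -Ez.
rewrite (exchange_big_dep (fun p => p \in C)) /=; last by move=> b p _ /andP[].
apply: ler_sum => p pC; rewrite (cD1 _ (t p)) ?tU // mulr_natr -sumr_const.
rewrite big_mkcond [leRHS]big_mkcond /=; apply: ler_sum => b _.
case: ifP => [/and3P[bB _ /andP[tQ /set0Pn[v]]]|_]; last by case: ifP => // _; exact: x_ge0.
rewrite !inE => /and3P[vU vX /eqP Ev].
rewrite -Ev imset_f // andbT Ev; case: eqP => // Eb; case/negP: tQ.
by rewrite inE Eb eqxx andbT (subsetP (UX pC)) ?tU.
Qed.

(* Abel summation against the cut inequalities for the blocks spanned by the
   light edges replaces the decomposition into arborescences. *)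
Lemma bridge (S : {set {set V}}) (W : P -> {set {set V}}) (c : {set V} -> R) :
  tree_on X S -> {in C, forall p, tree_on (U p) (W p)} ->
  {in S, forall e, 0 <= c e} ->
  exists s, s =i S /\
    \sum_(e in S) c e <= \sum_(p in C) x p * \sum_(e in greedy s (W p)) c e.
Proof.
move=> tS tW c_ge0; have [sS cS _] := tS.
pose s := sort (fun e f => c e <= c f) (enum S).
have ps : perm_eq s (enum S) by rewrite perm_sort.
have sE : s =i S by move=> e; rewrite (perm_mem ps) mem_enum.
have us : uniq s by rewrite sort_uniq enum_uniq.
have srt : sorted (fun e f => c e <= c f) s by apply: sort_sorted => e f; exact: le_total.
have sumS F : \sum_(e in S) F e = \sum_(j < size s) F (nth set0 s j) :> R.
  by rewrite -big_enum -(perm_big _ ps) /= (big_nth set0) big_mkord.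
exists s; split=> //.
have sumD W' : \sum_(e in greedy s W') c e =
    \sum_(j < size s) c (nth set0 s j) * (nth set0 s j \in greedy s W')%:R.
  rewrite -(sumS (fun e => c e * (e \in greedy s W')%:R)) big_mkcond [RHS]big_mkcond.
  apply: eq_bigr => e _; rewrite -sE; case: (boolP (e \in greedy s W')).
    by rewrite inE => /andP[-> _]; rewrite mulr1.
  by rewrite mulr0; case: ifP.
pose bl j Y : R := #|blocks [set e in take j s] Y|%:R.
(* The slack of the block inequality for the [j] lightest edges. *)
pose g j := \sum_(p in C) x p * (bl j (U p) - 1) - (bl j X - 1).
have g0 j : 0 <= g j by rewrite subr_ge0 cuts_blocks.
(* All of [S] connects [X], so every [U p] lies in a single block. *)
have gm : g (size s) <= 0.
  rewrite subr_le0 /bl; have -> : [set e in take (size s) s] = S.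
    by apply/setP=> e; rewrite take_size inE sE.
  apply: (@le_trans _ _ 0); last first.
    rewrite subr_ge0 ler1n card_gt0; apply/set0Pn.
    by exists (fingraph.root (adj S) r); apply: imset_f.
  apply: sumr_le0 => p pC; rewrite mulr_ge0_le0 ?x_ge0 // subr_le0 lern1.
  apply/card_le1_eqP=> _ _ /imsetP[a aU ->] /imsetP[b bU ->].
  by apply/eqP; rewrite root_adjE cS // (subsetP (UX pC)).
pose cj j := c (nth set0 s j).
have cj0 j : (j < size s)%N -> 0 <= cj j by move=> js; apply: c_ge0; rewrite -sE mem_nth.
have chom : {in gtn (size s) &, {homo cj : i j / (i <= j)%N >-> i <= j}}.
  move=> i j si sj ij.
  have tr : transitive (fun e f => c e <= c f) by move=> a b d; exact: le_trans.
  have rf : reflexive (fun e f => c e <= c f) by move=> a; exact: lexx.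
  exact: (sorted_leq_nth tr rf set0 srt).
(* A crude bound suffices, since it gets multiplied by [g (size s)], which is at most [0]. *)
pose M := \sum_(e in S) c e.
have M0 : 0 <= M by apply: sumr_ge0.
have cM : {in gtn (size s), forall j, 0 <= cj j <= M}.
  move=> j; rewrite inE => js; rewrite cj0 //= /M (bigD1 (nth set0 s j)) -?sE ?mem_nth //=.
  by rewrite lerDl sumr_ge0 // => e /andP[eS _]; exact: c_ge0.
have := abel_sum_ge g0 cM M0 chom.
have Mg : 0 <= - (M * g (size s)) by rewrite oppr_ge0 mulr_ge0_le0.
move=> /(le_trans Mg) {Mg} H.
rewrite -subr_ge0; apply: le_trans H _.
have -> : \sum_(p in C) x p * (\sum_(e in greedy s (W p)) c e) =
    \sum_(j < size s) cj j * \sum_(p in C) x p * (nth set0 s j \in greedy s (W p))%:R.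
  under eq_bigr => p _ do rewrite sumD mulr_sumr.
  rewrite exchange_big; apply: eq_bigr => j _; rewrite mulr_sumr.
  by apply: eq_bigr => p _; rewrite mulrCA.
rewrite sumS -sumrB; apply: ler_sum => j _.
rewrite -[X in _ <= _ - X]mulr1 -mulrBr ler_wpM2l ?cj0 //.
(* Edge [j] costs [X] at least one block, and costs [U p] at most one, and only when it is in the
   greedy drop of [p]. This bounds [g j - g j.+1]. *)
have blX : bl j.+1 X + 1 <= bl j X.
  by rewrite natr1 ler_nat; exact: (card_blocks_take_lt tS).
have : \sum_(p in C) x p * (bl j (U p) - 1) <=
    \sum_(p in C) x p * (bl j.+1 (U p) - 1) +
    \sum_(p in C) x p * (nth set0 s j \in greedy s (W p))%:R.
  rewrite -big_split; apply: ler_sum => p pC /=; rewrite -mulrDr ler_wpM2l ?x_ge0 //.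
  have [_ cW _] := tW _ pC.
  have : bl j (U p) <= bl j.+1 (U p) + (nth set0 s j \in greedy s (W p))%:R.
    by rewrite -natrD ler_nat; exact: (card_blocks_take_le sS).
  lra.
rewrite /g; lra.
Qed.

End Bridge.

(** * Edge sets of paths, and single edges as trees *)

Section EdgePaths.
Variable V : finType.
Implicit Types (S : {set {set V}}).

Lemma path_adjE S a p : path (adj S) a p = all (mem S) (path_edges a p).
Proof. by elim: p a => //= b p IH a; rewrite IH. Qed.

Lemma connect_neq_cover S a b : connect (adj S) a b -> a != b -> a \in cover S.
Proof.
case/connectP=> -[|c p] /=; first by move=> _ ->; rewrite eqxx.
case/andP=> acS _ _ _; apply/bigcupP; exists [set a; c] => //; exact: set21.
Qed.

Lemma path_edges_cover (a z : V) p :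
  z \in cover [set f in path_edges a p] -> z \in a :: p.
Proof.
case/bigcupP=> f; rewrite inE.
elim: p a => //= b p IH a; rewrite inE => /orP[/eqP-> |fp zf].
  by case/set2P=> ->; rewrite !inE eqxx ?orbT.
by have := IH _ fp zf; rewrite !inE => ->; rewrite orbT.
Qed.

Lemma tree_on_edge (e : {set V}) : #|e| = 2%N -> tree_on e [set e].
Proof.
move=> e2; split.
- by apply/subsetP=> f; rewrite !inE => /eqP ->; rewrite subxx e2.
- have /eqP/cards2P[x [y [xy E]]] := e2.
  move=> a b; rewrite E => /set2P[]-> /set2P[]->; rewrite ?connect0 //;
    by apply: connect1; rewrite /adj inE // setUC.
move=> c /andP[cyc uc]; rewrite -(card_uniqP uc) -e2; apply/subset_leq_card/subsetP.
by move=> x xc; have := next_cycle cyc xc; rewrite /adj inE => /eqP <-; rewrite set21.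
Qed.

End EdgePaths.

Lemma ex_argmax (R : realType) (T : finType) (P : T -> Prop) (F : T -> R) :
  (exists x, P x) -> exists2 x, P x & forall y, P y -> F y <= F x.
Proof.
case=> x0 /asboolT Px0; 
case: (@arg_maxP _ _ _ x0 (fun x => `[< P x >]) F Px0) => x /asboolP Px xmax.
by exists x => // y /asboolT; exact: xmax.
Qed.

(** * Harmonic numbers *)

Section Harmonic.
Variable R : realType.

Lemma Harm0 : Harm R 0 = 0.
Proof. by rewrite /Harm big_geq. Qed.

Lemma HarmS n : Harm R n.+1 = Harm R n + n.+1%:R^-1.
Proof. by rewrite /Harm big_nat_recr. Qed.

Lemma Harm_ge0 n : 0 <= Harm R n.
Proof. by apply: sumr_ge0 => i _; rewrite invr_ge0. Qed.

Lemma Harm_homo : {homo Harm R : m n / (m <= n)%N >-> m <= n}.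
Proof.
apply: homo_leq => [x|? ? ?|n]; [exact: lexx|exact: le_trans|].
by rewrite HarmS lerDl invr_ge0.
Qed.

Lemma Harm_gt0 n : (0 < n)%N -> 0 < Harm R n.
Proof.
by move=> /Harm_homo; apply: lt_le_trans; rewrite HarmS Harm0 add0r invr_gt0.
Qed.

(** Needed for an edge that keeps old witnesses and also receives new ones. *)
Lemma HarmD m n : Harm R (m + n) <= Harm R m + Harm R n.
Proof.
elim: n => [|n IH]; first by rewrite addn0 Harm0 addr0.
rewrite addnS !HarmS addrA lerD // lef_pV2 ?posrE ?ltr0n // ler_nat.
by rewrite ltnS leq_addl.
Qed.

(** Each of the [d] extra terms is at least [N%:R^-1]. For [N] the number of witnesses of an edge,
    this compares the loss of potential with [wbar]. *)
Lemma Harm_sub m d N : (m + d <= N)%N -> d%:R / N%:R <= Harm R (m + d) - Harm R m.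
Proof.
elim: d => [|d IH] le; first by rewrite addn0 subrr mul0r.
rewrite addnS in le *; have {}IH := IH (ltnW le).
rewrite HarmS -natr1 mulrDl mul1r addrAC lerD // lef_pV2 ?posrE ?ltr0n ?ler_nat //.
by apply: leq_trans le.
Qed.

End Harmonic.

(** * The invariant of the search, the potential, and the comparison with the LP *)

Section LocalSearch.
Variables (R : realType) (I : steiner_instance R) (wit : edgeset I -> edgeset I).
Hypothesis hwit : witness_construction wit.
Implicit Types (st : state I) (C D F : edgeset I).

(** The last clause makes [sol st] connect the terminals as [wtree st] does. It survives updates: an
    edge loses the witness [[set a; b]] only if that pair is dropped. *)
Definition good_state st := [/\ sol st \subset edges I,
  {in sol st, forall f, wset st f != set0},
  tree_on (terminals I) (wtree st) &
  forall a b, [set a; b] \in wtree st ->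
    connect (adj [set f in sol st | [set a; b] \in wset st f]) a b].

Lemma weight_ge0 F f : F \subset edges I -> f \in F -> 0 <= weight f.
Proof. by move=> /subsetP FE /FE fE; apply/ltW/weight_gt0. Qed.

Lemma wsum_ge0 F : F \subset edges I -> 0 <= wsum F.
Proof. by move=> FE; apply: sumr_ge0 => f; exact: weight_ge0. Qed.

Lemma wtree_prune st : wtree (prune st) = wtree st.
Proof.
apply/setP=> e; apply/bigcupP/bigcupP => -[f]; first by rewrite inE => /andP[fs _]; exists f.
by move=> fs ef; exists f => //; rewrite inE fs; apply/set0Pn; exists e.
Qed.

Lemma prune_good st : sol st \subset edges I -> tree_on (terminals I) (wtree st) ->
  (forall a b, [set a; b] \in wtree st ->
    connect (adj [set f in sol st | [set a; b] \in wset st f]) a b) ->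
  good_state (prune st).
Proof.
move=> sE tS cS; split.
- by apply: subset_trans sE; apply/subsetP=> f; rewrite inE => /andP[].
- by move=> f; rewrite inE => /andP[].
- by rewrite wtree_prune.
move=> a b; rewrite wtree_prune => /cS; apply: connect_adjS.
apply/subsetP=> f; rewrite !inE => /andP[-> ef]; rewrite ef !andbT.
by apply/set0Pn; exists [set a; b].
Qed.

Lemma potential_prune st : potential (prune st) = potential st.
Proof.
rewrite /potential big_mkcond [RHS]big_mkcond; apply: eq_bigr => f _; rewrite inE.
case: (f \in sol st) => //=; case: eqP => // ->.
by rewrite cards0 Harm0 mul0r.
Qed.

Lemma witness_sub C f : witness wit C f \subset wit C.
Proof. by apply/subsetP=> e; rewrite inE => /andP[]. Qed.

Lemma witness_connect C a b : component C -> [set a; b] \in wit C ->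
  connect (adj [set f in C | [set a; b] \in witness wit C f]) a b.
Proof.
move=> cC abW; have [[/subsetP sW _ _] _] := hwit cC; have [_ _ [_ cCC _]] := cC.
have := sW _ abW; rewrite inE => /andP[/subsetP abC _].
have aC : a \in cover C by have := abC a; rewrite set21 inE => /(_ isT)/andP[].
have bC : b \in cover C by have := abC b; rewrite set22 inE => /(_ isT)/andP[].
case/connectP: (cCC _ _ aC bC) => p0 p0th Eb; case/shortenP: p0th Eb => p pth up _ Eb.
apply/connectP; exists p => //; rewrite path_adjE; apply/allP=> f fp.
have fC : f \in C by move: (pth); rewrite path_adjE => /allP/(_ f fp).
rewrite /= inE fC inE abW; apply/asboolP; exists a, b, p; by split.
Qed.

Lemma bigcup_witness C : component C -> \bigcup_(f in C) witness wit C f = wit C.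
Proof.
move=> cC; apply/eqP; rewrite eqEsubset; apply/andP; split.
  by apply/bigcupsP=> f _; exact: witness_sub.
apply/subsetP=> e eW; have [[/subsetP/(_ _ eW)/pairsP[a [b [_ _ ab Ee]]] _ _] _] := hwit cC.
rewrite Ee in eW *; have /connect_neq_cover/(_ ab)/bigcupP[f] := witness_connect cC eW.
by rewrite inE => /andP[fC ef] _; apply/bigcupP; exists f.
Qed.

Lemma init_good F : steiner_solution F -> component F -> good_state (init_state wit F).
Proof.
move=> [FE cF] cmF; have SE : wtree (State F (witness wit F)) = wit F by exact: bigcup_witness.
apply: prune_good => //; rewrite SE; last first.
  by move=> a b; exact: witness_connect.
have [[sW cW acW] _] := hwit cmF; split=> //.
  by apply: subset_trans sW (pairsS (subsetIl _ _)).
(* A lone terminal may lie outside [cover F]; two distinct ones are both covered. *)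
move=> a b aT bT; have [->|ab] := eqVneq a b; first exact: connect0.
apply: cW; rewrite inE ?aT ?bT; first exact: connect_neq_cover (cF _ _ aT bT) ab.
by apply: connect_neq_cover (cF _ _ bT aT) _; rewrite eq_sym.
Qed.

Lemma wtree_update st C D : component C ->
  wtree (update wit st C D) = (wtree st :\: D) :|: wit C.
Proof.
move=> cC; rewrite wtree_prune -(bigcup_witness cC); apply/setP=> e; rewrite in_setU in_setD.
apply/bigcupP/idP => [[f /=]|].
  rewrite !inE => _; case: ifP => fs; case: ifP => fC; rewrite ?inE ?orbF //=.
  - case/orP=> [/andP[-> ef]|ef]; first by rewrite /=; apply/orP; left; apply/bigcupP; exists f.
    by apply/orP; right; apply/bigcupP; exists f => //; rewrite inE.
  - by case/andP=> -> ef /=; apply/orP; left; apply/bigcupP; exists f.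
  - by move=> ef; apply/orP; right; apply/bigcupP; exists f => //; rewrite inE.
case/orP=> [/andP[eD /bigcupP[f fs ef]]|/bigcupP[f fC ef]]; exists f => /=.
- by rewrite inE fs.
- by rewrite fs !inE eD ef.
- by rewrite inE fC orbT.
- by rewrite fC in_setU ef orbT.
Qed.

Lemma update_good st C D : good_state st -> component C ->
  drop_candidate wit st C D -> good_state (update wit st C D).
Proof.
move=> [sE _ _ cS] cC [_ tS]; have [CE _ _] := cC.
have SE := wtree_update st D cC; rewrite wtree_prune in SE.
apply: prune_good; rewrite ?SE //=; first by rewrite subUset sE.
move=> a b; rewrite in_setU in_setD => /orP[/andP[abD /cS]|/(witness_connect cC)].
  apply: connect_adjS; apply/subsetP=> f; rewrite !inE => /andP[fs ef].
  by rewrite fs in_setD abD ef.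
apply: connect_adjS; apply/subsetP=> f; rewrite inE => /andP[fC ef].
by rewrite !inE fC orbT /= -in_setU in_setU ef orbT.
Qed.

Lemma wbarsumE st D : wbarsum st D =
  \sum_(f in sol st) weight f / #|wset st f|%:R * #|wset st f :&: D|%:R.
Proof.
rewrite /wbarsum /wbar (exchange_big_dep (fun f => f \in sol st)) /=; last by move=> ? ? _ /andP[].
apply: eq_bigr => f fs; rewrite mulr_natr -[RHS]sumr_const; apply: eq_bigl => e.
by rewrite inE fs andbC.
Qed.

(** Each edge spreads its weight evenly over its nonempty witness set. *)
Lemma wbarsum_wtree st : good_state st -> wbarsum st (wtree st) = wsum (sol st).
Proof.
move=> [_ Wn _ _]; rewrite wbarsumE; apply: eq_bigr => f fs.
have -> : wset st f :&: wtree st = wset st f by apply/setIidPl; exact: bigcup_sup.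
by rewrite divfK // pnatr_eq0 cards_eq0 Wn.
Qed.

Lemma wbar_ge0 st e : sol st \subset edges I -> 0 <= wbar st e.
Proof.
by move=> sE; apply: sumr_ge0 => f /andP[fs _]; rewrite divr_ge0 // (weight_ge0 sE fs).
Qed.

Lemma potential_ge0 st : sol st \subset edges I -> 0 <= potential st.
Proof.
by move=> sE; apply: sumr_ge0 => f fs; rewrite mulr_ge0 ?Harm_ge0 // (weight_ge0 sE fs).
Qed.

(** Dropping [D] lowers the potential by at least [wbarsum st D], by [Harm_sub]; the edges of [C]
    add at most [ln 4 * wsum C], by the witness construction. Edges in both sets are handled by
    [HarmD]. *)
Lemma potential_update st C D : sol st \subset edges I -> component C ->
  potential (update wit st C D) <= potential st - gain st C D.
Proof.
move=> sE cC; have [_ hC] := hwit cC; have [CE _ _] := cC.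
rewrite potential_prune {1}/potential /=.
pose H1 f := Harm R #|wset st f :\: D| * weight f.
pose H2 f := Harm R #|witness wit C f| * weight f.
have : \sum_(f in sol st) H1 f <= potential st - wbarsum st D.
  rewrite wbarsumE -sumrB; apply: ler_sum => f fs.
  have := cardsID D (wset st f); rewrite addnC => Ec.
  have := @Harm_sub R #|wset st f :\: D| #|wset st f :&: D| #|wset st f|.
  rewrite Ec leqnn => /(_ isT); have w0 := weight_ge0 sE fs.
  have -> : weight f / #|wset st f|%:R * #|wset st f :&: D|%:R =
      #|wset st f :&: D|%:R / #|wset st f|%:R * weight f :> R.
    by rewrite [LHS]mulrC mulrCA mulrC.
  by move=> /(ler_wpM2r w0); rewrite mulrBl lerBrDl -lerBrDr.
suff : \sum_(f in sol st :|: C) Harm R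
    #|(if f \in sol st then wset st f :\: D else set0)
        :|: (if f \in C then witness wit C f else set0)| * weight f <=
    \sum_(f in sol st) H1 f + \sum_(f in C) H2 f.
  by rewrite /H2 /gain; lra.
rewrite big_mkcond [X in _ <= X + _]big_mkcond [X in _ <= _ + X]big_mkcond -big_split.
apply: ler_sum => f _ /=; rewrite in_setU.
have [fs|_] := boolP (f \in sol st); have [fC|_] := boolP (f \in C);
  rewrite /= ?setU0 ?set0U ?addr0 ?add0r //.
have w0 := weight_ge0 sE fs; rewrite -mulrDl ler_wpM2r //.
apply: le_trans (HarmD _ _ _); apply: Harm_homo.
by rewrite cardsU leq_subr.
Qed.

Lemma greedy_candidate st C s : good_state st -> component C -> s =i wtree st ->
  drop_candidate wit st C (greedy s (wit C)).
Proof.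
move=> [_ _ tS _] cC sE; split.
  by apply/subsetP=> e; rewrite inE sE => /andP[].
have [tW _] := hwit cC; exact: greedy_tree tS tW (subsetIl _ _) sE.
Qed.

Lemma ex_drop st C : good_state st -> component C -> exists D, is_drop wit st C D.
Proof.
move=> gs cC; have := @ex_argmax R _ (drop_candidate wit st C) (wbarsum st).
case=> [|D cD mD]; last by exists D.
by exists (greedy (enum (wtree st)) (wit C)); apply: greedy_candidate => // e; rewrite mem_enum.
Qed.

Lemma edge_kcomponent k e : (2 <= k)%N -> e \in edges I -> kcomponent k [set e].
Proof.
move=> k2 eE; have := subsetP (edges_pairs I) _ eE; rewrite inE => /andP[_ /eqP e2'].
have e2 : #|e| = 2%N := e2'.
have ce : cover [set e] = e by rewrite /cover big_set1.
split; first split; rewrite ?ce.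
- by rewrite sub1set.
- by apply/set0Pn; exists e; rewrite inE.
- exact: tree_on_edge.
by rewrite /cterm ce; apply: leq_trans k2; rewrite -e2 subset_leq_card // subsetIr.
Qed.

Lemma ex_best_choice k st C0 : (2 <= k)%N -> good_state st -> component C0 ->
  exists C D, best_choice wit k st C D.
Proof.
move=> k2 gs [/subsetP C0E /set0Pn[e /C0E eE] _].
have kc := edge_kcomponent k2 eE; have [D dD] := ex_drop gs kc.1.
have := @ex_argmax R _ (fun p : edgeset I * edgeset I =>
  kcomponent k p.1 /\ is_drop wit st p.1 p.2) (fun p => gain st p.1 p.2).
case; first by exists ([set e], D).
case=> C' D' /= [kC' dD'] m; exists C', D'; split=> // C2 D2 kC2 dD2.
exact: (m (C2, D2)).
Qed.

Lemma steiner_solution_good st : good_state st -> steiner_solution (sol st).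
Proof.
move=> [sE _ [_ cT _] cS]; split=> // a b aT bT.
apply: connect_sub (cT _ _ aT bT) => x y /cS; apply: connect_adjS.
by apply/subsetP=> f; rewrite inE => /andP[].
Qed.

(** Witness sets lie in the terminal tree, which has at most [#|vertex I|] edges. *)
Lemma potential_le_Harm st : good_state st ->
  potential st <= Harm R #|vertex I| * wsum (sol st).
Proof.
move=> [sE _ tS _]; rewrite /wsum mulr_sumr; apply: ler_sum => f fs.
rewrite ler_wpM2r ?(weight_ge0 sE fs) //; apply: Harm_homo.
apply: leq_trans (subset_leq_card (bigcup_sup f fs)) _.
exact: leq_trans (tree_on_card tS) (max_card _).
Qed.

(* Truncating the weights at the best gain [g] makes a bound on the total mass
   of [x] unnecessary: every nonempty drop loses at least one [g]. *)
Lemma wsum_le_lp_cost k st r x g : good_state st -> r \in terminals I ->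
  0 <= g -> (forall C D, kcomponent k C -> is_drop wit st C D -> gain st C D <= g) ->
  lp_feasible k r x ->
  wsum (sol st) - g * #|terminals I|%:R <= ln 4 * lp_cost k x.
Proof.
move=> gs rT g0 gmax [x0 cuts]; have [sE _ tS _] := gs.
pose c e := Num.max 0 (wbar st e - g).
have c0 e : 0 <= c e by rewrite /c le_max lexx.
have cD (p : edgeset I * vertex I) : p \in dcomponents I k -> component p.1.
  by rewrite inE => /andP[/asboolP[]].
have [|||||s [sS]] := @bridge _ R _ (dcomponents I k) x (terminals I) r
  (fun p => cterm p.1) (fun p => p.2) rT x0 _ _ _ _ (fun p => wit p.1) c tS.
- by move=> p; rewrite inE => /andP[].
- by move=> p _; exact: subsetIl.
- move=> Q Q0 QT; have := cuts Q Q0 QT; rewrite (eq_bigl _ _ (fun p => in_set _ _)).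
  by [].
- by move=> p /cD/hwit[].
- by move=> e _.
have cS : wsum (sol st) - g * #|terminals I|%:R <= \sum_(e in wtree st) c e.
  apply: (@le_trans _ _ (wsum (sol st) - g * #|wtree st|%:R)).
    by rewrite lerD2l lerN2 ler_wpM2l // ler_nat tree_on_card.
  rewrite -(wbarsum_wtree gs) mulr_natr -sumr_const -sumrB; apply: ler_sum => e _.
  by rewrite /c le_max lexx orbT.
move=> /(le_trans cS)/le_trans; apply.
rewrite /lp_cost mulr_sumr; apply: ler_sum => p pC.
rewrite mulrCA mulrA [x p * _]mulrC ler_wpM2r ?x0 //.
have [kC tC] : kcomponent k p.1 /\ p.2 \in cterm p.1.
  by move: pC; rewrite inE => /andP[/asboolP].
have [CE _ _] := kC.1.
set D := greedy s (wit p.1).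
have Dc : drop_candidate wit st p.1 D by apply: greedy_candidate kC.1 _.
have [D' dD'] := ex_drop gs kC.1.
(* The greedy drop is a candidate, so a maximal drop weighs at least as much. *)
have bD : wbarsum st D <= ln 4 * wsum p.1 + g.
  apply: le_trans (dD'.2 _ Dc) _; have := gmax _ _ kC dD'; rewrite /gain; lra.
(* If some edge of [D] weighs at least [g], truncating it alone saves [g]; otherwise all truncated
   weights on [D] vanish. *)
have [/exists_inP[e eD ge]|/negP ngD] := boolP [exists e in D, g <= wbar st e].
  apply: (@le_trans _ _ (wbarsum st D - g)); last by lra.
  rewrite /wbarsum (bigD1 e) //= [in leRHS](bigD1 e) //= addrAC.
  apply: lerD; first by rewrite /c ge_max subr_ge0 ge lexx.
  apply: ler_sum => f _; rewrite /c ge_max wbar_ge0 //=; lra.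
rewrite big1 => [|e eD].
  by rewrite mulr_ge0 ?wsum_ge0 // ln_ge0 // ler1n.
apply/max_idPl; rewrite subr_le0 leNgt; apply/negP=> /ltW ge.
by apply: ngD; apply/exists_inP; exists e.
Qed.

(** A shortest path in [F] from [Q] to a terminal outside [Q] has no terminals besides its ends, so
    its edges form a [k]-component that crosses the cut. Feasibility is needed for the infimum to be
    over a nonempty set. *)
Lemma lp_feasible1 k r F : (2 <= k)%N -> r \in terminals I -> component F ->
  steiner_solution F -> lp_feasible k r (fun=> 1).
Proof.
move=> k2 rT [FE _ [_ _ acF]] [_ cF]; split=> // Q Q0 /subsetP QT.
pose isn n := `[< exists a p, [/\ a \in Q, path (adj F) a p,
  last a p \in terminals I :\: Q & size p = n] >].
have exn : exists n, isn n.
  have /set0Pn[q qQ] := Q0; have := QT _ qQ; rewrite !inE => /andP[_ qT].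
  case/connectP: (cF _ _ qT rT) => p pth Er; exists (size p); apply/asboolP.
  exists q, p; split=> //; rewrite -Er inE rT andbT; apply/negP=> /QT.
  by rewrite !inE eqxx.
case: (ex_minnP exn) => n /asboolP[a [p [aQ pth lT sn]]] nmin.
set b := last a p in lT.
have aT : a \in terminals I by have := QT _ aQ; rewrite !inE => /andP[].
have [bT bQ] : b \in terminals I /\ b \notin Q by move: lT; rewrite inE => /andP[-> ->].
have ab : a != b by apply: contraNneq bQ => <-.
pose C := [set f in path_edges a p].
have CF : C \subset F.
  by apply/subsetP=> f; rewrite inE; move: f; apply/allP; rewrite -path_adjE.
have pC : path (adj C) a p by rewrite path_adjE; apply/allP=> f fp; rewrite /= inE.
have conC z : z \in a :: p -> connect (adj C) a z by exact: (path_connect pC).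
have cab : connect (adj C) a b by apply: conC; rewrite mem_last.
have aC : a \in cover C by exact: connect_neq_cover cab ab.
have bC : b \in cover C.
  by apply: (@connect_neq_cover _ _ _ a); rewrite 1?connect_adj_sym // eq_sym.
have CE : C \subset edges I by apply: subset_trans CF FE.
have termC : cterm C \subset [set a; b].
  apply/subsetP=> z; rewrite inE => /andP[zT /path_edges_cover zp].
  have [p1 [p2 [Ep Ez]]] : exists p1 p2, p = p1 ++ p2 /\ last a p1 = z.
    by case/splitPl: zp => p1 p2 Ez; exists p1, p2.
  move: pth; rewrite Ep cat_path Ez => /andP[pth1 pth2].
  have lz : last z p2 = b by rewrite /b Ep last_cat Ez.
  (* A further terminal in [Q] would start a shorter path, and one outside [Q] would end one. *)
  have [zQ|zQ] := boolP (z \in Q); rewrite in_set2.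
    have : (n <= size p2)%N.
      by apply: nmin; apply/asboolP; exists z, p2; rewrite lz.
    rewrite -sn Ep size_cat; case: p1 Ez {Ep pth1} => [/= -> _|v p1 _ /=].
      by rewrite eqxx.
    by rewrite addSn ltnNge leq_addl.
  have : (n <= size p1)%N.
    by apply: nmin; apply/asboolP; exists a, p1; rewrite Ez inE zQ.
  rewrite -sn Ep size_cat; case: p2 lz {Ep pth2} => [/= -> _|v p2 _ /=].
    by rewrite eqxx orbT.
  by rewrite addnS ltnNge leq_addr.
have kC : kcomponent k C.
  split; last by apply: leq_trans k2; rewrite (leq_trans (subset_leq_card termC)) // cards2 ab.
  split=> //; first by case/bigcupP: aC => f fC _; apply/set0Pn; exists f.
  split.
  - apply/subsetP=> f fC; rewrite inE (bigcup_sup f) //=.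
    by have := subsetP (edges_pairs I) _ (subsetP CE _ fC); rewrite inE => /andP[].
  - move=> u v /path_edges_cover/conC; rewrite connect_adj_sym => uC /path_edges_cover/conC.
    exact: connect_trans.
  move=> c /andP[cyc uc]; apply: acF; rewrite /ucycle uc andbT.
  by apply: sub_cycle cyc => u v; exact: (subsetP CF).
have inD : (C, b) \in deltam k Q.
  rewrite inE bQ; apply/andP; split.
    by rewrite inE; apply/andP; split; [exact/asboolP | rewrite inE bT].
  by apply/set0Pn; exists a; rewrite !inE aT aC aQ.
by rewrite (bigD1 (C, b)) //= lerDl sumr_ge0.
Qed.

End LocalSearch.

(** Twice the bound [ln (1 + x) <= x] at [x = - 2^-1]. *)
Lemma ln4_ge1 (R : realType) : 1 <= ln (4 : R).
Proof.
have -> : (4 : R) = 2 * 2 by rewrite -natrM.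
rewrite lnM ?posrE ?ltr0n //.
have := @le_ln1Dx R (- 2^-1); have -> : 1 + - 2^-1 = 2^-1 :> R by lra.
rewrite lnV ?posrE ?ltr0n // => H; have {}H := H ltac:(lra); lra.
Qed.

(** * Termination, and the invariant along a run *)

Section Termination.
Variables (R : realType) (I : steiner_instance R) (wit : edgeset I -> edgeset I).
Variables (eps : R) (k : nat).

Lemma ls_step_potential st st' : ls_step wit eps k st st' -> potential st' < potential st.
Proof. by case=> C D _ []. Qed.

(** Tabulating the witness map gives codes in a finite type that determine the potential. A strictly
    decreasing potential thus excludes infinite runs by pigeonhole. *)
Definition state_code (st : state I) : edgeset I * {ffun {set vertex I} -> edgeset I} :=
  (sol st, [ffun f => wset st f]).

Lemma state_code_potential st st' :
  state_code st = state_code st' -> potential st = potential st'.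
Proof.
case=> Es Ew; rewrite /potential Es; apply: eq_bigr => f _.
by have /ffunP/(_ f) := Ew; rewrite !ffunE => ->.
Qed.

Lemma local_search_terminates : ls_terminates wit eps k.
Proof.
case=> st [_ step].
have dec i d : potential (st (i + d.+1)%N) < potential (st i).
  elim: d => [|d IH]; first by rewrite addn1; exact: ls_step_potential.
  by rewrite addnS; apply: lt_trans (ls_step_potential (step _)) IH.
pose h (i : 'I_#|{: edgeset I * {ffun {set vertex I} -> edgeset I}}|.+1) := state_code (st i).
suff /leq_card : injective h by rewrite card_ord ltnn.
move=> i j /state_code_potential E; apply/val_inj => /=.
have [ij|ij|//] := ltngtP i j.
  by have := dec i (j - i.+1)%N; rewrite addnS -addSn subnKC // E ltxx.
by have := dec j (i - j.+1)%N; rewrite addnS -addSn subnKC // E ltxx.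
Qed.

Hypothesis hwit : witness_construction wit.

Lemma reachable_good st : ls_reachable wit eps k st ->
  good_state st /\ exists2 F : edgeset I, component F & steiner_solution F.
Proof.
elim=> [F sF cF|{}st _ _ [gs ex] [C D [kC [cD _] _] _]].
  by split; [exact: init_good | exists F].
by split=> //; apply: update_good kC.1 _.
Qed.

End Termination.

(** * The approximation ratio *)

Lemma approx_factor (R : realType) (w c L eps h : R) : 0 <= w -> 1 <= L ->
  0 < eps -> eps <= 1 -> w - h <= L * c -> h <= eps * w / (2 * L) ->
  w <= (L + eps) * c.
Proof.
move=> w0 L1 e0 e1 H1; rewrite ler_pdivlMr; last by lra.
move=> H2; have c0 : 0 <= c.
  have Hh : h <= w by nra.
  by rewrite -(@pmulr_rge0 _ L) //; lra.
have H : w * (2 * L - eps) <= 2 * L * (L * c) by nra.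
have pos : 0 < 2 * L - eps by lra.
rewrite -(ler_pM2r pos); apply: le_trans H _.
(* Here [eps * (L - eps)] is [(L + eps) * (2 * L - eps) - 2 * L * L]. *)
have : 0 <= c * (eps * (L - eps)) by rewrite !mulr_ge0 //; lra.
nra.
Qed.

Theorem theorem19 (R : realType) (eps : R) (k : nat)
    (heps0 : 0 < eps) (heps1 : eps <= 1) (hk : (2 <= k)%N)
    (I : steiner_instance R) (r : vertex I) (hr : r \in terminals I)
    (wit : edgeset I -> edgeset I) (hwit : witness_construction wit) :
  [/\ ls_terminates wit eps k,
      ls_never_stuck wit eps k &
      forall F : edgeset I, ls_returns wit eps k F ->
        steiner_solution F /\ wsum F <= (ln 4 + eps) * lp_value k r].
Proof.
split; first exact: local_search_terminates.
  by move=> st /(reachable_good hwit)[gs [F cF _]]; exact: ex_best_choice cF.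
move=> _ [st [C [D [/(reachable_good hwit)[gs [F0 cF0 sF0]] [kC dD gmax] stop ->]]]].
split; first exact: steiner_solution_good.
have [sE _ _ _] := gs; have L1 := ln4_ge1 R.
have w0 : 0 <= wsum (sol st) by exact: wsum_ge0.
have T0 : 0 < #|terminals I|%:R :> R.
  by rewrite ltr0n card_gt0; apply/set0Pn; exists r.
have H0 : 0 < Harm R #|vertex I|.
  by apply: Harm_gt0; apply/card_gt0P; exists r.
set delta := eps / (2 * Harm R #|vertex I| * ln 4 * #|terminals I|%:R) in stop.
(* A larger gain would make the potential fall enough for the search to continue. *)
have gD : gain st C D <= delta * potential st.
  have d0 : 0 <= delta by rewrite divr_ge0 ?ltW // !mulr_gt0 //; lra.
  have P0 := mulr_ge0 d0 (potential_ge0 sE).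
  have := potential_update hwit D sE kC.1.
  set pot' := potential _ => Pu; rewrite leNgt; apply/negP=> gt; apply: stop.
  by rewrite /enough_decrease -/pot' -/delta; split; lra.
(* The best gain may be negative, while the truncation needs a nonnegative level. *)
pose g := Num.max 0 (gain st C D).
have g0 : 0 <= g by rewrite le_max lexx.
(* The factors [Harm R #|vertex I|] and [#|terminals I|] in the denominator of [delta] cancel
   against the bound on the potential and the number of tree edges. *)
have gT : g * #|terminals I|%:R <= eps * wsum (sol st) / (2 * ln 4).
  have -> : eps * wsum (sol st) / (2 * ln 4) = delta *
      (Harm R #|vertex I| * wsum (sol st)) * #|terminals I|%:R.
    by rewrite /delta; field; rewrite !lt0r_neq0 //; lra.
  rewrite (ler_wpM2r (ltW T0)) //.
  have d0 : 0 <= delta by rewrite divr_ge0 ?ltW // !mulr_gt0 //; lra.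
  rewrite /g ge_max mulr_ge0 //=; last by rewrite mulr_ge0 // ltW.
  by apply: le_trans gD _; rewrite ler_wpM2l // potential_le_Harm.
have bound x : lp_feasible k r x -> wsum (sol st) <= (ln 4 + eps) * lp_cost k x.
  move=> fx; apply: approx_factor gT => //; apply: (wsum_le_lp_cost hwit) fx => //.
  by move=> C' D' kC' dD'; rewrite le_max gmax ?orbT.
have Le : 0 < ln 4 + eps by lra.
rewrite mulrC -ler_pdivrMr //; apply: lb_le_inf.
  by exists (@lp_cost R I k (fun=> 1)); exists (fun=> 1) => //; exact: lp_feasible1 cF0 sF0.
by move=> _ [x fx ->]; rewrite ler_pdivrMr // mulrC; exact: bound.
Qed.
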